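(* Let $n$ be a positive, odd, squarefree integer such that $n = u^2 + v^2$ for some integers $u, v$. Then every form $g$ in the same spinor genus as the ternary quadratic form $\langle 1,1,16n,0,0,0\rangle$, i.e. $x^2 + y^2 + 16 n z^2$, also integrally represents $n$; that is, there exist integers $x,y,z$ with $g(x,y,z) = n$.
   Context: The integer sextuple $\langle a,b,c,r,s,t\rangle$ denotes the ternary quadratic form $f(x,y,z) = a x^2 + b y^2 + c z^2 + r yz + s zx + t xy$. All forms considered are positive definite with integer coefficients $a,b,c,r,s,t$ and primitive ($\gcd(a,b,c,r,s,t)=1$). Spinor genus has its standard meaning: identify a form with a $\mathbf{Z}$-lattice $L$ in a quadratic space $V$ over $\mathbf{Q}$. A lattice $M$ on $V$ is in the spinor genus of $L$ if there are $\sigma \in O(V)$ and, for every prime $p$, an element $\Sigma_p \in O'(V_p)$ (the kernel of the spinor norm on $SO(V_p)$, where $V_p = V \otimes \mathbf{Q}_p$) such that $M_p = \sigma \Sigma_p L_p$ for every prime $p$. A form is in the spinor genus of a given form if it is integrally equivalent to the form of such a lattice $M$. *)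

(* Defs.v *)
From HB Require Import structures.
From mathcomp Require Import all_boot all_order all_algebra.
From mathcomp Require Import boolp classical_sets.

Set Implicit Arguments.
Unset Strict Implicit.
Unset Printing Implicit Defensive.
Set Warnings "-redundant-canonical-projection".

Import Order.TTheory GRing.Theory Num.Theory.

(* The ring of p-adic integers is the inverse limit of the rings Z/p^k: an
   element is the sequence of its residues in [0, p^k).  Coherence forces
   [residue x k < p ^ k], so distinct elements have distinct sequences. *)
Record padic_int (p : nat) (pp : prime p) := PadicInt {
  residue :> nat -> nat;
  residueP : forall k, residue k = residue k.+1 %% p ^ k }.

Section PadicInt.
Local Open Scope nat_scope.
Variables (p : nat) (pp : prime p).
Local Notation Zp := (padic_int pp).

Lemma padic_int_eq (x y : Zp) : (forall k, x k = y k) -> x = y.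
Proof.
case: x y => [x Px] [y Py] /= xy; have {}xy : x = y by apply/funext.
by subst y; congr PadicInt; apply: Prop_irrelevance.
Qed.

Lemma residue_mod (x : Zp) k : x k %% p ^ k = x k.
Proof. by rewrite (residueP x) modn_mod. Qed.

Lemma residue_le (x : Zp) k m : k <= m -> x m %% p ^ k = x k.
Proof.
move=> /subnK <-; elim: (m - k) => [|j IH]; first exact: residue_mod.
rewrite addSn -IH (residueP x (j + k)) modn_dvdm //.
by rewrite dvdn_exp2l // leq_addl.
Qed.

Lemma of_coherent_proof (f : nat -> nat) :
    (forall k, f k.+1 = f k %[mod p ^ k]) ->
  forall k, f k %% p ^ k = (f k.+1 %% p ^ k.+1) %% p ^ k.
Proof. by move=> fP k; rewrite modn_dvdm ?dvdn_exp2l // fP. Qed.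

Definition of_coherent f (fP : forall k, f k.+1 = f k %[mod p ^ k]) : Zp :=
  @PadicInt p pp (fun k => f k %% p ^ k) (of_coherent_proof fP).

Lemma residueS (x : Zp) k : x k.+1 = x k %[mod p ^ k].
Proof. by rewrite residue_mod -residueP. Qed.

Lemma padic_cst_proof n k : n = n %[mod p ^ k]. Proof. by []. Qed.

Lemma padic_add_proof (x y : Zp) k : x k.+1 + y k.+1 = x k + y k %[mod p ^ k].
Proof. by rewrite -modnDm !residueS modnDm. Qed.

Lemma padic_mul_proof (x y : Zp) k : x k.+1 * y k.+1 = x k * y k %[mod p ^ k].
Proof. by rewrite -modnMm !residueS modnMm. Qed.

Lemma residue_ltn (x : Zp) k : x k < p ^ k.
Proof. by rewrite -residue_mod ltn_mod expn_gt0 prime_gt0. Qed.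

Lemma padic_opp_proof (x : Zp) k :
  p ^ k.+1 - x k.+1 = p ^ k - x k %[mod p ^ k].
Proof.
apply/eqP; rewrite -(eqn_modDr (x k.+1)) subnK; last exact/ltnW/residue_ltn.
rewrite -modnDmr residueS modnDmr subnK; last exact/ltnW/residue_ltn.
by rewrite modnn expnS modnMl.
Qed.

Definition padic_cst n := of_coherent (padic_cst_proof n).
Definition padic_add x y := of_coherent (padic_add_proof x y).
Definition padic_mul x y := of_coherent (padic_mul_proof x y).
Definition padic_opp x := of_coherent (padic_opp_proof x).

HB.instance Definition _ := gen_eqMixin Zp.
HB.instance Definition _ := gen_choiceMixin Zp.

Lemma padic_addA : associative padic_add.
Proof.
by move=> x y z; apply: padic_int_eq => k /=; rewrite modnDml modnDmr addnA.
Qed.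

Lemma padic_addC : commutative padic_add.
Proof. by move=> x y; apply: padic_int_eq => k /=; rewrite addnC. Qed.

Lemma padic_add0 : left_id (padic_cst 0) padic_add.
Proof.
by move=> x; apply: padic_int_eq => k /=; rewrite mod0n add0n residue_mod.
Qed.

Lemma padic_addN : left_inverse (padic_cst 0) padic_opp padic_add.
Proof.
move=> x; apply: padic_int_eq => k /=.
by rewrite modnDml subnK ?modnn ?mod0n //; exact/ltnW/residue_ltn.
Qed.

HB.instance Definition _ :=
  GRing.isZmodule.Build Zp padic_addA padic_addC padic_add0 padic_addN.

Lemma padic_mulA : associative padic_mul.
Proof.
by move=> x y z; apply: padic_int_eq => k /=; rewrite modnMml modnMmr mulnA.
Qed.

Lemma padic_mulC : commutative padic_mul.
Proof. by move=> x y; apply: padic_int_eq => k /=; rewrite mulnC. Qed.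

Lemma padic_mul1 : left_id (padic_cst 1) padic_mul.
Proof.
by move=> x; apply: padic_int_eq => k /=; rewrite modnMml mul1n residue_mod.
Qed.

Lemma padic_mulDl : left_distributive padic_mul padic_add.
Proof.
move=> x y z; apply: padic_int_eq => k /=.
by rewrite modnMml modnDmr modnDml mulnDl.
Qed.

Lemma padic_1neq0 : padic_cst 1 != 0%R.
Proof.
apply/eqP => /(congr1 (fun x : Zp => x 1)) /=.
by rewrite expn1 mod0n modn_small ?prime_gt1.
Qed.

HB.instance Definition _ := GRing.Zmodule_isComNzRing.Build Zp
  padic_mulA padic_mulC padic_mul1 padic_mulDl padic_1neq0.

Definition padic_unit : {pred Zp} := fun x => `[< exists y : Zp, (y * x = 1)%R >].

Definition padic_inv (x : Zp) : Zp :=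
  if pselect (exists y : Zp, (y * x = 1)%R) is left xU
  then projT1 (cid xU) else x.

Lemma padic_mulVx :
  {in padic_unit, left_inverse 1%R padic_inv (@GRing.mul Zp)}.
Proof.
move=> x /asboolP xU; rewrite /padic_inv; case: pselect => [yx|/(_ xU)//].
by case: cid.
Qed.

Lemma padic_unitPl (x y : Zp) : (y * x = 1)%R -> padic_unit x.
Proof. by move=> yx; apply/asboolP; exists y. Qed.

Lemma padic_invr_out : {in [predC padic_unit], padic_inv =1 id}.
Proof.
move=> x /negP xNU; rewrite /padic_inv; case: pselect => // xU.
by case: xNU; apply/asboolP.
Qed.

HB.instance Definition _ := GRing.ComNzRing_hasMulInverse.Build Zp
  padic_mulVx padic_unitPl padic_invr_out.

Lemma padic_neq0 (x : Zp) :
  x != 0%R -> exists2 k, 0 < k & forall m, k <= m -> 0 < x m /\ logn p (x m) < k.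
Proof.
move=> x_neq0.
have [k xk] : exists k, x k <> 0.
  apply/not_existsP => x0; move/eqP: x_neq0; apply; apply: padic_int_eq => k /=.
  by rewrite mod0n; apply: contrapT; exact: x0.
have xk_ndvd m : k <= m -> ~~ (p ^ k %| x m).
  by move=> km; rewrite /dvdn residue_le //; apply/eqP.
exists k => [|m km].
  by case: k xk {xk_ndvd} => // xk; case: xk; rewrite residueP modn1.
have xm_gt0 : 0 < x m.
  by rewrite lt0n; apply: contra (xk_ndvd _ km) => /eqP ->; rewrite dvdn0.
by split => //; rewrite ltnNge -pfactor_dvdn // xk_ndvd.
Qed.

Lemma padic_integral (x y : Zp) : (x * y = 0)%R -> (x == 0%R) || (y == 0%R).
Proof.
move=> xy0; apply: contrapT => /negP.
rewrite negb_or => /andP[/padic_neq0[k k_gt0 xk] /padic_neq0[m m_gt0 ym]].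
move/(congr1 (fun z : Zp => z (k + m))): xy0 => /=; rewrite mod0n.
have [x_gt0 xlog] := xk _ (leq_addr m k).
have [y_gt0 ylog] := ym _ (leq_addl k m).
move/eqP; apply/negP; rewrite -/(dvdn _ _) pfactor_dvdn ?muln_gt0 ?x_gt0 //.
rewrite lognM // -ltnNge; apply: (leq_trans _ (leq_add xlog (ltnW ylog))).
by rewrite addSn.
Qed.

HB.instance Definition _ := GRing.ComUnitRing_isIntegral.Build Zp padic_integral.

End PadicInt.

Definition padic (p : nat) (pp : prime p) : fieldType := {fraction padic_int pp}.

Local Open Scope classical_set_scope.
Local Open Scope ring_scope.

(* <a, b, c, r, s, t> is a x^2 + b y^2 + c z^2 + r y z + s z x + t x y. *)
Record ternary := Ternary { ca : int; cb : int; cc : int;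
                            cr : int; cs : int; ct : int }.

Definition eval (f : ternary) (R : comNzRingType) (x y z : R) : R :=
  (ca f)%:~R * x ^+ 2 + (cb f)%:~R * y ^+ 2 + (cc f)%:~R * z ^+ 2
  + (cr f)%:~R * (y * z) + (cs f)%:~R * (z * x) + (ct f)%:~R * (x * y).

Definition qform (f : ternary) (R : comNzRingType) (v : 'cV[R]_3) : R :=
  eval f (v 0 0) (v 1 0) (v 2 0).

Definition positive_definite (f : ternary) :=
  forall v : 'cV[rat]_3, v != 0 -> 0 < qform f v.

Definition primitive (f : ternary) : Prop :=
  gcdz (ca f) (gcdz (cb f) (gcdz (cc f) (gcdz (cr f) (gcdz (cs f) (ct f))))) = 1.

Definition integrally_equivalent (g h : ternary) :=
  exists2 U : 'M[int]_3, U \in unitmx &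
    forall v : 'cV[int]_3, qform g v = qform h (U *m v).

Section QuadraticSpace.
Variables (f : ternary) (K : fieldType).
Implicit Types (A : 'M[K]_3) (u v x : 'cV[K]_3).

(* The polar form, so that [polar x x = 2 * qform f x]. *)
Definition polar u v : K := qform f (u + v) - qform f u - qform f v.

Definition in_O A :=
  A \in unitmx /\ forall x, qform f (A *m x) = qform f x.

Definition in_SO A := in_O A /\ \det A = 1.

Definition symmetry v x : 'cV[K]_3 := x - (polar x v / qform f v) *: v.

(* The spinor norm of A, as a coset of the squares in the group K^* : if A is
   the product of the symmetries in v_1, ..., v_m, it is the class of
   qform f v_1 * ... * qform f v_m. *)
Definition spinor_norm A : set K :=
  [set c | exists (vs : seq 'cV[K]_3) (d : K),
     [/\ {in vs, forall v, qform f v != 0},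
         forall x, A *m x = foldr symmetry x vs,
         d != 0 & c = d ^+ 2 * \prod_(v <- vs) qform f v]].

(* A coset is trivial if and only if it contains 1. *)
Definition in_O' A := in_SO A /\ spinor_norm A 1.

End QuadraticSpace.

Arguments in_O f {K} A.
Arguments in_O' f {K} A.

(* Lattices on the three-dimensional space over rat, seen as column vectors. *)
Definition Zspan (B : 'M[rat]_3) : set 'cV[rat]_3 :=
  [set B *m map_mx intr v | v in [set: 'cV[int]_3]].

Definition is_basis (M : set 'cV[rat]_3) (B : 'M[rat]_3) :=
  B \in unitmx /\ M = Zspan B.

Definition is_lattice (M : set 'cV[rat]_3) := exists B, is_basis M B.

(* M_p, the Z_p-submodule of V_p generated by M. *)
Definition localization (p : nat) (pp : prime p) (M : set 'cV[rat]_3) :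
    set 'cV[padic pp]_3 :=
  [set v | exists (m : nat) (c : 'I_m -> padic_int pp) (w : 'I_m -> 'cV[rat]_3),
     (forall i, M (w i)) /\
     v = \sum_i tofrac (c i) *: map_mx (ratr : rat -> padic pp) (w i)].

Arguments localization {p} pp M.

(* The lattice M is in the spinor genus of L, on the quadratic space
   (rat^3, qform f). *)
Definition same_spinor_genus (f : ternary) (L M : set 'cV[rat]_3) :=
  exists2 sigma : 'M[rat]_3, in_O f sigma &
    forall (p : nat) (pp : prime p),
      exists2 Sigma : 'M[padic pp]_3, in_O' f Sigma &
        localization pp M =
        [set map_mx ratr sigma *m (Sigma *m v) | v in localization pp L].

(* h is the form of the lattice M, in some basis of M. *)
Definition form_of_lattice (f : ternary) (M : set 'cV[rat]_3) (h : ternary) :=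
  exists2 B, is_basis M B &
    forall v : 'cV[rat]_3, qform h v = qform f (B *m v).

Definition in_spinor_genus (f g : ternary) :=
  exists (M : set 'cV[rat]_3) (h : ternary),
    [/\ is_lattice M, same_spinor_genus f (Zspan 1%:M) M,
        form_of_lattice f M h & integrally_equivalent g h].

Definition squarefree (n : nat) :=
  forall d : nat, (d ^ 2 %| n)%N -> d = 1%N.

(* Main.v *)
From HB Require Import structures.
Require Import Defs.
From mathcomp Require Import all_boot all_order all_algebra.
From mathcomp Require Import ring lra zify.
From mathcomp Require Import boolp classical_sets.

Set Implicit Arguments.
Unset Strict Implicit.
Unset Printing Implicit Defensive.

Import Order.TTheory GRing.Theory Num.Theory.

Local Open Scope ring_scope.

(** The form f = x^2 + y^2 + 16 n z^2 is n times the norm of the pure quaternion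
    with coordinates (u x + v y) / n, (u y - v x) / n and 4 z, because
    n = u^2 + v^2.  Under this identification [to_pure] of the quadratic space
    with the pure quaternions, the lattice Z^3 contains Z i + Z j + 4 Z k, and
    a vector has f-value n exactly when its quaternion has norm 1.  So it is
    enough to find a rotated image of i in every lattice M of the spinor genus.

    An element of SO with trivial spinor norm is conjugation by a quaternion of
    norm 1 ([in_O'_conjugation]): it is a product of an even number of
    symmetries, and the symmetry in y is, up to sign, conjugation by y.  Hence
    M_p is the image under sigma of the lattice Z_p^3 conjugated by some q_p of
    norm 1 over Q_p.

    The integral quaternions have class number one.  What is needed from this
    is that one rational quaternion Q / m of norm 1 can replace all the q_p at
    once: Q / m = q_p o_p with o_p integral over Z_p, for the finitely many p
    that divide a denominator in the change of coordinates to a basis of M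
    ([simultaneous_approximation]); at the other primes Q / m itself is
    integral.  For one prime, Q is an element of minimal
    norm in the right ideal that a multiple of q_p cuts out, and division with
    remainder shows that its norm divides the norm of every element of the
    ideal ([minimal_norm_dvd]).  The primes are then treated one after the
    other.

    The required vector of M is the image under sigma of the rotation of i by
    Q / m.  At p, this rotation is the conjugate by q_p of the rotation of i by
    o_p, so the vector lies in M_p as soon as the latter rotation lies in
    Z_p i + Z_p j + 4 Z_p k.  Only p = 2 matters: if four squares sum to 1, then
    exactly one term is odd, and the k-coordinate 2 (b d - a c) of the rotation
    is a multiple of 4 ([padic_conjugate_qi]).  The spinor norm is essential
    here: the rotation by 1 + i + j, of norm 3, takes i to a vector with
    k-coordinate - 2 / 3. *)

(** * Quaternions *)

Record quat (R : Type) := Quat { qre : R; qim_i : R; qim_j : R; qim_k : R }.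

Definition qmap (R S : Type) (f : R -> S) (x : quat R) : quat S :=
  let: Quat a b c d := x in Quat (f a) (f b) (f c) (f d).

Section Quaternions.
Variable R : comNzRingType.
Implicit Types (x y z : quat R) (e : R).

Definition qadd x y :=
  let: Quat a b c d := x in let: Quat a' b' c' d' := y in
  Quat (a + a') (b + b') (c + c') (d + d').

Definition qscale e x :=
  let: Quat a b c d := x in Quat (e * a) (e * b) (e * c) (e * d).

Definition qmul x y :=
  let: Quat a b c d := x in let: Quat a' b' c' d' := y in
  Quat (a * a' - b * b' - c * c' - d * d')
       (a * b' + b * a' + c * d' - d * c')
       (a * c' - b * d' + c * a' + d * b')
       (a * d' + b * c' - c * b' + d * a').

Definition qconj x := let: Quat a b c d := x in Quat a (- b) (- c) (- d).

Definition qnorm x : R :=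
  let: Quat a b c d := x in a ^+ 2 + b ^+ 2 + c ^+ 2 + d ^+ 2.

Definition qone : quat R := Quat 1 0 0 0.

Definition conjugate x y := qmul (qmul x y) (qconj x).

Lemma qmulA x y z : qmul x (qmul y z) = qmul (qmul x y) z.
Proof. by case: x y z => ? ? ? ? [? ? ? ?] [? ? ? ?]; congr Quat; ring. Qed.

Lemma qmulDl x y z : qmul (qadd x y) z = qadd (qmul x z) (qmul y z).
Proof. by case: x y z => ? ? ? ? [? ? ? ?] [? ? ? ?]; congr Quat; ring. Qed.

Lemma qmulDr x y z : qmul x (qadd y z) = qadd (qmul x y) (qmul x z).
Proof. by case: x y z => ? ? ? ? [? ? ? ?] [? ? ? ?]; congr Quat; ring. Qed.

Lemma qmulZl e x y : qmul (qscale e x) y = qscale e (qmul x y).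
Proof. by case: x y => ? ? ? ? [? ? ? ?]; congr Quat; ring. Qed.

Lemma qmulZr e x y : qmul x (qscale e y) = qscale e (qmul x y).
Proof. by case: x y => ? ? ? ? [? ? ? ?]; congr Quat; ring. Qed.

Lemma qmulr1 x : qmul x qone = x.
Proof. by case: x => ? ? ? ?; congr Quat; ring. Qed.

Lemma qmul1 x : qmul qone x = x.
Proof. by case: x => ? ? ? ?; congr Quat; ring. Qed.

Lemma qscaleA e e' x : qscale e (qscale e' x) = qscale (e * e') x.
Proof. by case: x => ? ? ? ?; congr Quat; ring. Qed.

Lemma qscaleDr e x y : qscale e (qadd x y) = qadd (qscale e x) (qscale e y).
Proof. by case: x y => ? ? ? ? [? ? ? ?]; congr Quat; ring. Qed.

Lemma qscale1 x : qscale 1 x = x.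
Proof. by case: x => ? ? ? ?; congr Quat; ring. Qed.

Lemma qconjD x y : qconj (qadd x y) = qadd (qconj x) (qconj y).
Proof. by case: x y => ? ? ? ? [? ? ? ?]; congr Quat; ring. Qed.

Lemma qconjZ e x : qconj (qscale e x) = qscale e (qconj x).
Proof. by case: x => ? ? ? ?; congr Quat; ring. Qed.

Lemma qconjM x y : qconj (qmul x y) = qmul (qconj y) (qconj x).
Proof. by case: x y => ? ? ? ? [? ? ? ?]; congr Quat; ring. Qed.

Lemma qconjK x : qconj (qconj x) = x.
Proof. by case: x => ? ? ? ?; congr Quat; ring. Qed.

Lemma qmul_conj x : qmul x (qconj x) = qscale (qnorm x) qone.
Proof. by case: x => ? ? ? ?; congr Quat; rewrite /qnorm; ring. Qed.

Lemma qmul_conjl x : qmul (qconj x) x = qscale (qnorm x) qone.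
Proof. by case: x => ? ? ? ?; congr Quat; rewrite /qnorm; ring. Qed.

Lemma qnormM x y : qnorm (qmul x y) = qnorm x * qnorm y.
Proof. by case: x y => ? ? ? ? [? ? ? ?] /=; ring. Qed.

Lemma qnormZ e x : qnorm (qscale e x) = e ^+ 2 * qnorm x.
Proof. by case: x => ? ? ? ? /=; ring. Qed.

Lemma qnorm_conj x : qnorm (qconj x) = qnorm x.
Proof. by case: x => ? ? ? ? /=; ring. Qed.

Lemma conjugateZl e x y :
  conjugate (qscale e x) y = qscale (e ^+ 2) (conjugate x y).
Proof. by case: x y => ? ? ? ? [? ? ? ?]; congr Quat; ring. Qed.

Lemma conjugateM x y z : conjugate (qmul x y) z = conjugate x (conjugate y z).
Proof. by rewrite /conjugate qconjM !qmulA. Qed.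

Lemma conjugate1 y : conjugate qone y = y.
Proof. by case: y => ? ? ? ?; congr Quat; ring. Qed.

Lemma qnorm1 : qnorm qone = 1 :> R.
Proof. by rewrite /= expr0n expr1n !addr0. Qed.

Lemma conjugateZr e x y : conjugate x (qscale e y) = qscale e (conjugate x y).
Proof. by rewrite /conjugate qmulZr qmulZl. Qed.

Lemma qre_conjugate x y : qre y = 0 -> qre (conjugate x y) = 0.
Proof. by case: x y => ? ? ? ? [? ? ? ?] /= ->; ring. Qed.

Lemma qre_scale e x : qre x = 0 -> qre (qscale e x) = 0.
Proof. by case: x => ? ? ? ? /= ->; rewrite mulr0. Qed.

Lemma qnorm_conjugate x y : qnorm (conjugate x y) = qnorm x ^+ 2 * qnorm y.
Proof. by rewrite /conjugate !qnormM qnorm_conj; ring. Qed.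

End Quaternions.

Arguments qone {R}.

Section QuaternionMaps.
Variables (R S : comNzRingType) (f : {rmorphism R -> S}).

Lemma qmap_mul x y : qmap f (qmul x y) = qmul (qmap f x) (qmap f y).
Proof.
by case: x y => ? ? ? ? [? ? ? ?]; rewrite /= !(rmorphB, rmorphD, rmorphM).
Qed.

Lemma qmap_conj x : qmap f (qconj x) = qconj (qmap f x).
Proof. by case: x => ? ? ? ?; rewrite /= !rmorphN. Qed.

Lemma qmap_scale e x : qmap f (qscale e x) = qscale (f e) (qmap f x).
Proof. by case: x => ? ? ? ?; rewrite /= !rmorphM. Qed.

Lemma qnorm_map x : qnorm (qmap f x) = f (qnorm x).
Proof. by case: x => ? ? ? ?; rewrite /= !(rmorphD, rmorphXn). Qed.

Lemma qmap_conjugate x y :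
  qmap f (conjugate x y) = conjugate (qmap f x) (qmap f y).
Proof. by rewrite /conjugate !qmap_mul qmap_conj. Qed.

End QuaternionMaps.

(** * Division with remainder in the integral quaternions *)

Lemma centered_division (N z : int) : 0 < N ->
  exists a : int, - N <= 2 * (z - N * a) < N.
Proof.
move=> N_gt0; exists ((2 * z + N) %/ (2 * N))%Z.
have := divz_eq (2 * z + N) (2 * N).
have := modz_ge0 (2 * z + N) (_ : 2 * N != 0).
have := ltz_pmod (2 * z + N) (_ : 0 < 2 * N).
move: (_ %/ _)%Z (_ %% _)%Z => a r r_lt r_ge E.
have {}r_lt : r < 2 * N by apply: r_lt; lia.
have {}r_ge : 0 <= r by apply: r_ge; lia.
have -> : 2 * (z - N * a) = r - N by rewrite mulrBr; lia.
lia.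
Qed.

(** An element q of minimal norm in a right ideal J of the integral quaternions
    need not generate J, but it generates J over the larger ring of Hurwitz
    quaternions: the remainder of a division by q has norm at most the norm of
    q, with equality only when all four coordinates of the exact quotient are
    halves of odd integers.  Norms of Hurwitz quaternions are integers, so
    divisibility of norms holds all the same. *)
Section MinimalNorm.
Variables (J : quat int -> Prop) (q : quat int).
Hypotheses (Jq : J q) (q_gt0 : 0 < qnorm q).
Hypothesis JB : forall x a, J x -> J (qadd x (qscale (-1) (qmul q a))).
Hypothesis q_min : forall x, J x -> 0 < qnorm x -> qnorm q <= qnorm x.

Lemma qnorm_ge0 (x : quat int) : 0 <= qnorm x.
Proof. by case: x => a b c d /=; rewrite !addr_ge0 ?sqr_ge0. Qed.

Lemma minimal_norm_dvd x : J x -> (qnorm q %| qnorm x)%Z.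
Proof.
move=> Jx; move: (q_gt0) (q_min); set N := qnorm q => N_gt0 N_min.
have [z0 [z1 [z2 [z3 Ez]]]] : exists z0 z1 z2 z3,
    qmul (qconj q) x = Quat z0 z1 z2 z3.
  by case: (qmul _ x) => z0 z1 z2 z3; exists z0, z1, z2, z3.
have [a0 e0] := centered_division z0 N_gt0.
have [a1 e1] := centered_division z1 N_gt0.
have [a2 e2] := centered_division z2 N_gt0.
have [a3 e3] := centered_division z3 N_gt0.
have Nz : N * qnorm x = z0 ^+ 2 + z1 ^+ 2 + z2 ^+ 2 + z3 ^+ 2.
  by rewrite -[RHS](_ : qnorm (Quat z0 z1 z2 z3) = _) // -Ez qnormM qnorm_conj.
set r := qadd x (qscale (-1) (qmul q (Quat a0 a1 a2 a3))).
have Jr : J r := JB _ Jx.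
have Nr : N * qnorm r = (z0 - N * a0) ^+ 2 + (z1 - N * a1) ^+ 2
                      + (z2 - N * a2) ^+ 2 + (z3 - N * a3) ^+ 2.
  rewrite {1}/N -(qnorm_conj q) -qnormM /r qmulDr qmulZr qmulA qmul_conjl Ez.
  by rewrite qmulZl qmul1 /= -/N; ring.
(* The remainder of the division of conj(q) x by N has coordinates e with
   |2 e| <= N; equality can only occur as 2 e = - N. *)
have sq_le (e : int) : - N <= 2 * e < N -> 4 * e ^+ 2 <= N ^+ 2.
  move=> /andP[eN Ne]; rewrite -subr_ge0.
  have -> : N ^+ 2 - 4 * e ^+ 2 = (N - 2 * e) * (N + 2 * e) by ring.
  by apply: mulr_ge0; lia.
have sq_eq (e : int) : - N <= 2 * e < N -> N ^+ 2 <= 4 * e ^+ 2 -> 2 * e = - N.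
  move=> /andP[eN Ne]; rewrite -subr_le0.
  have -> : N ^+ 2 - 4 * e ^+ 2 = (N - 2 * e) * (N + 2 * e) by ring.
  by rewrite pmulr_rle0; lia.
have r_ge0 := qnorm_ge0 r.
have [r_lt|r_ge] := ltP (qnorm r) N.
  have r0 : qnorm r = 0.
    apply/eqP; case: (ltgtP (qnorm r) 0) r_ge0 => // r_gt0 _.
    by have := N_min _ Jr r_gt0; rewrite leNgt r_lt.
  move: Nr; rewrite r0 mulr0 => Nr.
  have sq_le0_eq (e e' : int) : (e - e') ^+ 2 <= 0 -> e = e'.
    by move=> h; apply/eqP; rewrite -subr_eq0 -sqrf_eq0 eq_le h sqr_ge0.
  have sq0 := sqr_ge0 (z0 - N * a0); have sq1 := sqr_ge0 (z1 - N * a1).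
  have sq2 := sqr_ge0 (z2 - N * a2); have sq3 := sqr_ge0 (z3 - N * a3).
  have z0E : z0 = N * a0 by apply: sq_le0_eq; lra.
  have z1E : z1 = N * a1 by apply: sq_le0_eq; lra.
  have z2E : z2 = N * a2 by apply: sq_le0_eq; lra.
  have z3E : z3 = N * a3 by apply: sq_le0_eq; lra.
  apply/dvdzP; exists (a0 ^+ 2 + a1 ^+ 2 + a2 ^+ 2 + a3 ^+ 2).
  apply: (@mulfI _ N); first by rewrite gt_eqF.
  by rewrite Nz z0E z1E z2E z3E; ring.
have NN : N ^+ 2 <= N * qnorm r by rewrite expr2 ler_pM2l.
have l0 := sq_le _ e0; have l1 := sq_le _ e1.
have l2 := sq_le _ e2; have l3 := sq_le _ e3.
(* All four coordinates of the quotient are halves of odd integers, so q divides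
   x on the left in the Hurwitz order. *)
have E0 := sq_eq _ e0 ltac:(lra); have E1 := sq_eq _ e1 ltac:(lra).
have E2 := sq_eq _ e2 ltac:(lra); have E3 := sq_eq _ e3 ltac:(lra).
apply/dvdzP.
exists (a0 ^+ 2 - a0 + (a1 ^+ 2 - a1) + (a2 ^+ 2 - a2) + (a3 ^+ 2 - a3) + 1).
apply: (@mulfI _ (4 * N)); first by rewrite gt_eqF // mulr_gt0.
transitivity ((2 * z0) ^+ 2 + (2 * z1) ^+ 2 + (2 * z2) ^+ 2 + (2 * z3) ^+ 2).
  by rewrite -mulrA Nz; ring.
have -> : 2 * z0 = N * (2 * a0 - 1) by lia.
have -> : 2 * z1 = N * (2 * a1 - 1) by lia.
have -> : 2 * z2 = N * (2 * a2 - 1) by lia.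
have -> : 2 * z3 = N * (2 * a3 - 1) by lia.
ring.
Qed.

End MinimalNorm.

(** * Divisibility in the p-adic integers *)

Section PadicDivisibility.
Variables (p : nat) (pp : prime p).
Local Notation Zp := (padic_int pp).
Implicit Types x y : Zp.

Lemma residueD x y j : (x + y) j = ((x j + y j) %% p ^ j)%N.
Proof. by []. Qed.

Lemma residueM x y j : (x * y) j = ((x j * y j) %% p ^ j)%N.
Proof. by []. Qed.

Lemma residue_nat n j : (n%:R : Zp) j = (n %% p ^ j)%N.
Proof.
elim: n => [|n IH]; first by [].
by rewrite -addn1 natrD residueD IH modnDml modnDmr.
Qed.

Lemma residue_p_exp_mul x j : (p%:R ^+ j * x) j = 0%N.
Proof. by rewrite -natrX residueM residue_nat modnn mul0n mod0n. Qed.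

Lemma residue0_dvd x j : x j = 0%N -> exists y, x = p%:R ^+ j * y.
Proof.
move=> xj0.
have p_gt0 i : (0 < p ^ i)%N by rewrite expn_gt0 prime_gt0.
have coh k : (x (k.+1 + j) %/ p ^ j = x (k + j) %/ p ^ j %[mod p ^ k])%N.
  by rewrite !modn_divl -expnD residue_mod residue_le // leq_add2r.
exists (of_coherent pp coh); apply: padic_int_eq => k.
rewrite -natrX residueM residue_nat /= modnMml modnMmr mulnC divnK.
  by rewrite residue_le // leq_addr.
by rewrite /dvdn residue_le ?leq_addl // xj0.
Qed.

Lemma residue_decomposition x j : exists y, x = (x j)%:R + p%:R ^+ j * y.
Proof.
have [y xE] : exists y, x - (x j)%:R = p%:R ^+ j * y.
  apply: residue0_dvd.
  have : (x - (x j)%:R + (x j)%:R) j = x j by rewrite subrK.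
  rewrite residueD residue_nat residue_mod => /eqP.
  rewrite -{3}(residue_mod x j) -[X in _ == (X %% _)%N]add0n.
  by rewrite eqn_modDr mod0n residue_mod => /eqP.
by exists y; rewrite -xE addrC subrK.
Qed.

(** The inverses modulo the powers of p are unique, so they are automatically
    coherent. *)
Lemma residue1_unit x : x 1%N != 0%N -> x \is a GRing.unit.
Proof.
move=> x1_neq0.
have co k : coprime (x k.+1) (p ^ k.+1).
  rewrite coprime_sym coprime_pexpl // prime_coprime //.
  by have := residue_le x (ltn0Sn k); rewrite expn1 /dvdn => ->.
have /choice[f fP] k : exists a, (a * x k = 1 %[mod p ^ k])%N.
  case: k => [|k]; first by exists 0%N; rewrite !modn1.
  have xk_gt0 : (0 < x k.+1)%N.
    rewrite lt0n; apply: contraNneq x1_neq0 => xk0.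
    by rewrite -(@residue_le _ _ x 1 k.+1) // xk0 mod0n.
  have [a b E _] := egcdnP (p ^ k.+1) xk_gt0.
  by exists a; rewrite E (eqP (co k)) modnMDl.
have coh k : (f k.+1 = f k %[mod p ^ k])%N.
  have fP' : (f k.+1 * x k = 1 %[mod p ^ k])%N.
    rewrite -modnMmr -residueS modnMmr.
    rewrite -[LHS](@modn_dvdm (p ^ k.+1)) ?dvdn_exp2l // fP.
    by rewrite modn_dvdm ?dvdn_exp2l.
  rewrite -[f k.+1]muln1 -modnMmr -(fP k) modnMmr mulnCA -modnMmr fP' modnMmr.
  by rewrite muln1.
suff E : of_coherent pp coh * x = 1.
  by apply/unitrP; exists (of_coherent pp coh); split; rewrite // mulrC.
by apply: padic_int_eq => k; rewrite residueM /= modnMml fP.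
Qed.

Lemma coprime_unit n : coprime p n -> (n%:R : Zp) \is a GRing.unit.
Proof.
move=> co; apply: residue1_unit; rewrite residue_nat expn1.
by move: co; rewrite prime_coprime.
Qed.

Lemma padic_int_factor x : x != 0 ->
  exists j u, [/\ x = p%:R ^+ j * u & u \is a GRing.unit].
Proof.
move=> x_neq0; have [k k_gt0 /(_ k (leqnn k))[xk_gt0 _]] := padic_neq0 x_neq0.
have ex_k : exists k, (0 < x k)%N by exists k.
have [j xj_gt0 j_min] := ex_minnP ex_k.
case: j xj_gt0 j_min => [|j] xj_gt0 j_min.
  by move: (residue_ltn x 0); rewrite expn0 ltnNge xj_gt0.
have xj0 : x j = 0%N.
  by apply/eqP; rewrite -leqn0 leqNgt; apply/negP => /j_min; rewrite ltnn.
have [u xE] := residue0_dvd xj0; exists j, u; split=> //.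
apply: residue1_unit; apply/eqP => u1_0.
have [w uE] := @residue0_dvd u 1 u1_0.
by move: xj_gt0; rewrite xE uE mulrA -exprD addn1 residue_p_exp_mul.
Qed.

Lemma padic_nat_neq0 n : (0 < n)%N -> (n%:R : Zp) != 0.
Proof.
move=> n_gt0; apply/eqP => /(congr1 (fun x : Zp => x n)).
rewrite (residue_nat 0) mod0n residue_nat modn_small.
  by move=> n0; rewrite n0 in n_gt0.
by rewrite ltn_expl // prime_gt1.
Qed.

Lemma padic_dvd_int (a : int) y j :
  a%:~R = p%:R ^+ j * y -> ((p ^ j)%N%:Z %| a)%Z.
Proof.
move=> aE; have [z zE] : exists z : Zp, `|a|%N%:R = p%:R ^+ j * z.
  case: a aE => k aE; first by exists y.
  by exists (- y); rewrite mulrN -aE NegzE rmorphN opprK.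
rewrite dvdzE /= /dvdn -(residue_nat `|a| j) zE.
by rewrite residue_p_exp_mul.
Qed.

Lemma tofrac_nat_neq0 n : (0 < n)%N -> (n%:R : padic pp) != 0.
Proof.
by move=> n_gt0; rewrite -(rmorph_nat (@tofrac Zp)) tofrac_eq0 padic_nat_neq0.
Qed.

Lemma intr_padic_neq0 (a : int) : a != 0 -> (a%:~R : padic pp) != 0.
Proof.
case: a => k k_neq0; first by apply: tofrac_nat_neq0; rewrite lt0n.
by rewrite NegzE rmorphN oppr_eq0; apply: tofrac_nat_neq0.
Qed.

Lemma padic_denominator (x : padic pp) :
  exists k (y : Zp), p%:R ^+ k * x = tofrac y.
Proof.
have [n [d [d_neq0 xE]]] : exists n d : Zp, d != 0 /\ x * tofrac d = tofrac n.
  elim/quotW: x => r; exists \n_r, \d_r; split; first exact: denom_ratioP.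
  rewrite !piE; apply/eqmodP; rewrite /= FracField.equivfE /FracField.mulf.
  rewrite !numden_Ratio ?(oner_eq0, mulf_neq0, denom_ratioP) //.
  by rewrite !mulr1 mulrC.
have [k [u [dE u_unit]]] := padic_int_factor d_neq0.
exists k, (n / u); rewrite rmorphM /= -xE dE -mulrA -rmorphM /= -mulrA.
by rewrite divrr // mulr1 rmorphXn /= rmorph_nat mulrC.
Qed.

End PadicDivisibility.

(** Every rational is a quotient of integers in many ways, and all of them have
    the same image in a field of characteristic zero ([ratrE]); comparing sums
    and products over a common denominator makes [ratr] a ring morphism. *)
Section RatrCharacteristicZero.
Variable F : fieldType.
Hypothesis intr_neq0 : forall a : int, a != 0 -> (a%:~R : F) != 0.

Lemma ratrE (x : rat) (a d : int) : d != 0 -> x * d%:~R = a%:~R ->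
  (ratr x : F) = a%:~R / d%:~R.
Proof.
move=> d_neq0 xE; rewrite /ratr; apply/eqP.
rewrite eqr_div ?intr_neq0 ?denq_neq0 // -!rmorphM /=; apply/eqP.
by congr _%:~R; apply: (@intr_inj rat); rewrite !rmorphM /= -xE numqE mulrAC.
Qed.

Lemma ratr_zmod_morphism : zmod_morphism (ratr : rat -> F).
Proof.
move=> x y; have dx := denq_neq0 x; have dy := denq_neq0 y.
rewrite (@ratrE _ (numq x * denq y - numq y * denq x) (denq x * denq y)).
- by rewrite /ratr !(rmorphB, rmorphM) /=; field; rewrite !intr_neq0.
- by rewrite mulf_neq0.
by rewrite !(rmorphB, rmorphM) /= !numqE; ring.
Qed.

Lemma ratr_monoid_morphism : monoid_morphism (ratr : rat -> F).
Proof.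
split=> [|x y]; first by rewrite /ratr divr1.
have dx := denq_neq0 x; have dy := denq_neq0 y.
rewrite (@ratrE _ (numq x * numq y) (denq x * denq y)).
- by rewrite /ratr !rmorphM /=; field; rewrite !intr_neq0.
- by rewrite mulf_neq0.
by rewrite !rmorphM /= !numqE; ring.
Qed.

End RatrCharacteristicZero.

Section PadicRatr.
Variables (p : nat) (pp : prime p).
Local Notation K := (padic pp).

(** A separate name to carry the morphism structure: [ratr] already carries the
    one into ordered fields. *)
Definition rat_padic : rat -> K := ratr.

HB.instance Definition _ := GRing.isZmodMorphism.Build rat K rat_padic
  (ratr_zmod_morphism (@intr_padic_neq0 p pp)).
HB.instance Definition _ := GRing.isMonoidMorphism.Build rat K rat_padic
  (ratr_monoid_morphism (@intr_padic_neq0 p pp)).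

Lemma padic_integer_rat_denominator (x : rat) (y : padic_int pp) :
  rat_padic x = tofrac y -> ~~ (p %| `|denq x|)%N.
Proof.
move=> xE; apply/negP => p_den.
have numE : (numq x)%:~R = (denq x)%:~R * y.
  apply/eqP; rewrite -tofrac_eq rmorphM /= !rmorph_int -xE.
  rewrite /rat_padic /ratr mulrC divfK //.
  by rewrite intr_padic_neq0 // denq_neq0.
have /dvdzP[d dE] : (p%:Z %| denq x)%Z by [].
have : (p%:Z %| numq x)%Z.
  rewrite -[p]expn1; apply: (@padic_dvd_int p pp _ (d%:~R * y)).
  by rewrite numE dE rmorphM /= expr1 mulrA [_ * p%:~R]mulrC.
rewrite dvdzE /= => p_num; have := prime_gt1 pp.
have := coprime_num_den x; rewrite /coprime => /eqP g1.
by have := dvdn_gcd p `|numq x| `|denq x|; rewrite g1 p_num p_den dvdn1 => /eqP ->.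
Qed.

End PadicRatr.

(** * Approximation of local quaternions of norm one *)

Lemma qmap_intr (R S : comNzRingType) (f : {rmorphism R -> S}) x :
  qmap f (qmap intr x) = qmap intr x.
Proof. by case: x => a b c d; rewrite /= !rmorph_int. Qed.

Lemma qscale_inj (F : idomainType) (e : F) : e != 0 -> injective (qscale e).
Proof.
move=> e0 [a b c d] [a' b' c' d'] [].
by do 4!move=> /(mulfI e0)->.
Qed.

Section OnePrime.
Variables (p : nat) (pp : prime p).
Local Notation Zp := (padic_int pp).
Local Notation K := (padic pp).

Lemma qdenominator (x : quat K) :
  exists k (t : quat Zp), qscale (p%:R ^+ k) x = qmap (@tofrac Zp) t.
Proof.
case: x => a b c d.
have [ka [a' aE]] := padic_denominator a.
have [kb [b' bE]] := padic_denominator b.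
have [kc [c' cE]] := padic_denominator c.
have [kd [d' dE]] := padic_denominator d.
exists (ka + kb + kc + kd)%N.
exists (Quat (p%:R ^+ (kb + kc + kd) * a') (p%:R ^+ (ka + kc + kd) * b')
             (p%:R ^+ (ka + kb + kd) * c') (p%:R ^+ (ka + kb + kc) * d')).
rewrite /= !rmorphM /= -aE -bE -cE -dE !rmorphXn /= !rmorph_nat !exprD.
by congr Quat; ring.
Qed.

Lemma qresidue (t : quat Zp) j :
  exists (T : quat int) s, t = qadd (qmap intr T) (qscale (p%:R ^+ j) s).
Proof.
case: t => a b c d.
have [a' aE] := residue_decomposition a j.
have [b' bE] := residue_decomposition b j.
have [c' cE] := residue_decomposition c j.
have [d' dE] := residue_decomposition d j.
exists (Quat (a j)%:Z (b j)%:Z (c j)%:Z (d j)%:Z), (Quat a' b' c' d').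
by rewrite /= -aE -bE -cE -dE.
Qed.

Lemma qnorm_add_scale (R : comNzRingType) (e : R) x s :
  exists r, qnorm (qadd x (qscale e s)) = qnorm x + e * r.
Proof.
case: x s => a b c d [a' b' c' d'] /=.
exists (2 * (a * a' + b * b' + c * c' + d * d')
        + e * (a' ^+ 2 + b' ^+ 2 + c' ^+ 2 + d' ^+ 2)).
ring.
Qed.

(** The x with conj(T) x divisible by p^k form a right ideal that contains T and
    p^k, and all their norms are divisible by p^k.  An element Q of minimal norm
    has a norm dividing those of T and p^k, that is p^k (1 + p c) and p^(2 k);
    this leaves only p^k. *)
Lemma prime_power_norm_quaternion k (T : quat int) c :
  qnorm T = (p ^ k)%N%:Z * (1 + p%:Z * c) ->
  exists Q y : quat int, qnorm Q = (p ^ k)%N%:Z /\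
    qmul (qconj T) Q = qscale (p ^ k)%N%:Z y.
Proof.
set P := (p ^ k)%N%:Z => NT.
have P_gt0 : 0 < P by rewrite ltz_nat expn_gt0 prime_gt0.
have P_neq0 : P != 0 by rewrite gt_eqF.
have coP e : coprimez (p ^ e)%N%:Z (1 + p%:Z * c).
  rewrite coprimezE /= coprimeXl // -[p]/`|p%:Z|%N -coprimezE /coprimez.
  by rewrite addrC mulrC gcdzMDl gcdz1.
pose J x := exists y, qmul (qconj T) x = qscale P y.
have JT : J T.
  exists (qscale (1 + p%:Z * c) qone).
  by rewrite qmul_conjl NT qscaleA.
have JP : J (qscale P qone) by exists (qconj T); rewrite qmulZr qmulr1.
have JB x a q : J q -> J x -> J (qadd x (qscale (-1) (qmul q a))).
  move=> [y qE] [z xE]; exists (qadd z (qscale (-1) (qmul y a))).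
  rewrite qmulDr qmulZr qmulA qE xE qmulZl qscaleDr !qscaleA.
  by congr qadd; congr qscale; ring.
pose normJ m := `[< exists2 x, J x & qnorm x = m.+1%:Z >].
have ex_m : exists m, normJ m.
  exists ((p ^ k) ^ 2).-1%N; apply/asboolP; exists (qscale P qone) => //.
  rewrite qnormZ prednK ?expn_gt0 ?prime_gt0 //= /P.
  by rewrite PoszM -expr2; ring.
have [m /asboolP[Q JQ NQ] m_min] := ex_minnP ex_m.
have Q_gt0 : 0 < qnorm Q by rewrite NQ.
have Q_min x : J x -> 0 < qnorm x -> qnorm Q <= qnorm x.
  move=> Jx; case E : (qnorm x) => [[|i]|] // _; rewrite NQ lez_nat ltnS.
  by apply: m_min; apply/asboolP; exists x.
have dvQ := minimal_norm_dvd Q_gt0 (fun x a => @JB x a Q JQ) Q_min.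
have [y yE] := JQ.
exists Q, y; split=> //.
have dvQP : (qnorm Q %| P)%Z.
  have dvQT : (qnorm Q %| P * (1 + p%:Z * c))%Z by rewrite -NT dvQ.
  have dvQPP : (qnorm Q %| P * P)%Z.
    by have := dvQ _ JP; rewrite qnormZ /= [X in (_ %| _ * X)%Z](_ : _ = 1) ?mulr1.
  rewrite -(@Gauss_dvdzl _ _ (1 + p%:Z * c)) //.
  rewrite coprimezE; apply: coprime_dvdl dvQPP _.
  by rewrite -coprimezE coprimezMl !coP.
have dvPQ : (P %| qnorm Q)%Z.
  rewrite -(@Gauss_dvdzr _ (1 + p%:Z * c)) ?coP //.
  apply/dvdzP; exists (qnorm y); apply: (mulfI P_neq0).
  by rewrite mulrA -NT -(qnorm_conj T) -qnormM yE qnormZ; ring.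
have absQ : `|qnorm Q|%N = (p ^ k)%N.
  by apply/eqP; rewrite eqn_dvd; apply/andP; split; [exact: dvQP|exact: dvPQ].
by rewrite -(gez0_abs (qnorm_ge0 Q)) absQ.
Qed.

(** Clearing denominators turns x into a quaternion t of norm p^(2 k) over Z_p.
    Replacing t by an integral T modulo p^(2 k + 1) leaves the norm of T with
    exactly the factor p^(2 k), while congruences modulo p^(2 k) do not see the
    difference. *)
Lemma local_quaternion_approximation (x : quat K) : qnorm x = 1 ->
  exists k (Q : quat int) (o : quat Zp),
    qnorm Q = ((p ^ k) ^ 2)%N%:Z /\
    qmul (qconj x) (qmap intr Q) = qscale (p ^ k)%N%:R (qmap (@tofrac Zp) o).
Proof.
move=> Nx; have [k [t tE]] := qdenominator x.
have Nt : qnorm t = p%:R ^+ (2 * k).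
  apply/eqP; rewrite -tofrac_eq -qnorm_map -tE qnormZ Nx mulr1.
  by rewrite rmorphXn /= rmorph_nat -exprM mulnC.
have [T [s tTs]] := qresidue t (2 * k).+1.
have [r rE] := qnorm_add_scale (p%:R ^+ (2 * k).+1) (qmap intr T) s.
have /dvdzP[c cE] : ((p ^ (2 * k).+1)%N%:Z %| qnorm T - (p ^ (2 * k))%N%:Z)%Z.
  apply: (@padic_dvd_int p pp _ (- r)).
  rewrite rmorphB /= -qnorm_map -[((p ^ _)%N%:~R)]/((p ^ (2 * k))%N%:R).
  by rewrite natrX -Nt {1}tTs rE; ring.
have NT : qnorm T = (p ^ (2 * k))%N%:Z * (1 + p%:Z * c).
  by move: cE; rewrite expnS PoszM => /eqP; rewrite subr_eq => /eqP ->; ring.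
have [Q [y [NQ yE]]] := prime_power_norm_quaternion NT.
exists k, Q, (qadd (qmap intr y) (qscale p%:R (qmul (qconj s) (qmap intr Q)))).
split; first by rewrite NQ expnM expnAC.
have pK : (p%:R ^+ k : K) != 0.
  by rewrite expf_neq0 // tofrac_nat_neq0 // prime_gt0.
apply: (qscale_inj pK); rewrite -[LHS]qmulZl -[X in qmul X _ = _]qconjZ tE tTs.
rewrite natrX qscaleA -exprD addnn -mul2n.
have -> : p%:R ^+ (2 * k) = tofrac (p%:R ^+ (2 * k) : Zp).
  by rewrite rmorphXn /= rmorph_nat.
rewrite -qmap_conj -[qmap intr Q](qmap_intr (@tofrac Zp)) -qmap_mul -qmap_scale.
congr qmap; rewrite qconjD qmulDl qconjZ qmulZl qscaleDr qscaleA.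
congr qadd; last by rewrite -exprSr.
by rewrite -qmap_conj -qmap_mul yE qmap_scale -[RHS]/(qscale _ _) -natrX.
Qed.

End OnePrime.

(** A further prime p0 is treated by approximating not x(p0) itself but what is
    left of it after the quaternion Q / m found for the previous primes; this
    multiplies Q / m on the right by a quaternion that is integral away from
    p0, which does no harm at the previous primes. *)
Lemma simultaneous_approximation (s : seq nat)
    (x : forall p (pp : prime p), quat (padic pp)) :
  (forall p (pp : prime p), p \in s -> qnorm (x p pp) = 1) ->
  exists (Q : quat int) (m : nat),
    [/\ (0 < m)%N, qnorm Q = (m ^ 2)%N%:Z,
        forall p, prime p -> (p %| m)%N -> p \in s
      & forall p (pp : prime p), p \in s -> exists o : quat (padic_int pp),
          qmul (qconj (x p pp)) (qmap intr Q)
          = qscale m%:R (qmap (@tofrac (padic_int pp)) o)].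
Proof.
elim: s => [|p0 s IH] Nx.
  exists qone, 1%N; split=> // p pp; rewrite dvdn1 => /eqP p1.
  by rewrite p1 in pp.
have [|Q [m [m_gt0 NQ mP QP]]] := IH.
  by move=> p pp ps; apply: Nx; rewrite inE ps orbT.
have [old|new] := boolP (~~ prime p0 || (p0 \in s)).
  exists Q, m; split=> // [p pp pm|p pp]; first by rewrite inE mP ?orbT.
  rewrite inE => /orP[/eqP E|/QP //].
  by subst p; apply: QP; move: old; rewrite pp.
move: new; rewrite negb_or negbK => /andP[pp0 p0s].
have mK : (m%:R : padic pp0) != 0 by rewrite tofrac_nat_neq0.
pose x' := qscale m%:R^-1 (qmul (qconj (qmap intr Q)) (x p0 pp0)).
have Nx' : qnorm x' = 1.
  rewrite qnormZ qnormM qnorm_conj qnorm_map NQ Nx ?mem_head // mulr1.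
  by rewrite -[X in _ * X]/((m ^ 2)%N%:R) natrX -exprMn mulVf // expr1n.
have [k [Q' [o [NQ' oE]]]] := local_quaternion_approximation Nx'.
exists (qmul Q Q'), (m * p0 ^ k)%N; split.
- by rewrite muln_gt0 m_gt0 expn_gt0 prime_gt0.
- by rewrite qnormM NQ NQ' -PoszM -expnMn.
- move=> p pp; rewrite Euclid_dvdM // inE => /orP[/mP->//|]; first by rewrite orbT.
  by rewrite Euclid_dvdX // => /andP[]; rewrite dvdn_prime2 // => ->.
move=> p pp; rewrite inE; have [E _|p_neq /= /QP[o' o'E]] := eqVneq p p0.
  subst p0; rewrite (bool_irrelevance pp pp0); exists o.
  rewrite natrM -qscaleA -oE /x' qconjZ qconjM qconjK !qmulZl qscaleA.
  by rewrite divff // qscale1 qmap_mul !qmulA.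
have u_unit : ((p0 ^ k)%N%:R : padic_int pp) \is a GRing.unit.
  by apply: coprime_unit; rewrite coprimeXr // prime_coprime // dvdn_prime2.
exists (qscale ((p0 ^ k)%N%:R)^-1 (qmul o' (qmap intr Q'))).
rewrite qmap_mul qmulA o'E qmulZl natrM -qscaleA; congr qscale.
rewrite -[(p0 ^ k)%N%:R](rmorph_nat (@tofrac (padic_int pp))) -qmap_scale.
by rewrite qscaleA divrr // qscale1 qmap_mul qmap_intr.
Qed.

(** * The quadratic space as pure quaternions *)

Definition cV3 (R : Type) (x y z : R) : 'cV[R]_3 :=
  \col_i nth z [:: x; y] i.

Definition mx3 (R : Type) (a b c d e f g h k : R) : 'M[R]_3 :=
  \matrix_(i, j) nth k (nth [::] [:: [:: a; b; c]; [:: d; e; f]; [:: g; h]] i) j.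

Lemma cV3E (R : nzRingType) (v : 'cV[R]_3) : v = cV3 (v 0 0) (v 1 0) (v 2 0).
Proof.
apply/matrixP => i j; rewrite ord1 mxE.
by case: i => [[|[|[|//]]] lt_i] /=; congr (v _ _); apply: val_inj.
Qed.

Lemma mul_mx3_cV3 (R : comNzRingType) (a b c d e f g h k x y z : R) :
  mx3 a b c d e f g h k *m cV3 x y z =
  cV3 (a * x + b * y + c * z) (d * x + e * y + f * z) (g * x + h * y + k * z).
Proof.
apply/matrixP => i j; rewrite !mxE !big_ord_recl big_ord0 !mxE /= addr0 addrA.
by case: i => [[|[|[|//]]] lt_i].
Qed.

Lemma det_mx3 (R : comNzRingType) (a b c d e f g h k : R) :
  \det (mx3 a b c d e f g h k) =
  a * (e * k - f * h) - b * (d * k - f * g) + c * (d * h - e * g).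
Proof.
rewrite (expand_det_row _ 0) !big_ord_recl big_ord0 /cofactor.
rewrite !(expand_det_row _ 0) !big_ord_recl !big_ord0 /cofactor !det_mx11 !mxE /=.
by rewrite /bump /= !addr0; ring.
Qed.

Lemma mulmx_ext (R : nzRingType) m n (X Y : 'M[R]_(m, n)) :
  (forall w : 'cV[R]_n, X *m w = Y *m w) -> X = Y.
Proof.
move=> XY; apply/matrixP => i j.
by move/matrixP/(_ i 0): (XY (delta_mx j 0)); rewrite -!colE !mxE.
Qed.

Section PureQuaternions.
Variables (K : fieldType) (n u v : int).
Hypothesis nE : n = u ^+ 2 + v ^+ 2.
Hypotheses (n_neq0 : n%:~R != 0 :> K) (two_neq0 : 2 != 0 :> K).
Local Notation f := (Ternary 1 1 (16 * n) 0 0 0).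

Definition of_pure (w : quat K) : 'cV[K]_3 :=
  let: Quat _ b c d := w in
  cV3 (u%:~R * b - v%:~R * c) (v%:~R * b + u%:~R * c) (d / 4).

Definition to_pure (x : 'cV[K]_3) : quat K :=
  Quat 0 ((u%:~R * x 0 0 + v%:~R * x 1 0) / n%:~R)
         ((u%:~R * x 1 0 - v%:~R * x 0 0) / n%:~R) (4 * x 2 0).

Lemma four_neq0 : 4 != 0 :> K.
Proof. by rewrite -[4]/(2 * 2)%N%:R natrM mulf_neq0. Qed.

Lemma nKE : n%:~R = u%:~R ^+ 2 + v%:~R ^+ 2 :> K.
Proof. by rewrite nE rmorphD !rmorphXn. Qed.

Lemma to_pureK x : of_pure (to_pure x) = x.
Proof.
have := n_neq0; rewrite [RHS]cV3E /= nKE => n0.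
by congr cV3; field; rewrite ?four_neq0.
Qed.

Lemma of_pureK w : qre w = 0 -> to_pure (of_pure w) = w.
Proof.
case: w => a b c d /= ->; have := n_neq0; rewrite nKE => n0.
rewrite /to_pure !mxE /= nKE.
by congr Quat; field; rewrite ?four_neq0.
Qed.

Lemma qform_of_pure w : qre w = 0 -> qform f (of_pure w) = n%:~R * qnorm w.
Proof.
case: w => a b c d /= ->; rewrite /qform /eval /= !mxE /=.
rewrite rmorphM /= nKE; field; exact: four_neq0.
Qed.

Lemma qform_to_pure x : qform f x = n%:~R * qnorm (to_pure x).
Proof. by rewrite -qform_of_pure // to_pureK. Qed.

Lemma to_pureD x y : to_pure (x + y) = qadd (to_pure x) (to_pure y).
Proof. by rewrite /to_pure !mxE /=; congr Quat; field. Qed.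

Lemma to_pureZ e x : to_pure (e *: x) = qscale e (to_pure x).
Proof. by rewrite /to_pure !mxE /=; congr Quat; field. Qed.

(** Conjugation by a pure y fixes y and changes the sign of its orthogonal
    complement, where quaternions anticommute with y. *)
Lemma symmetry_pure y x : qform f y != 0 ->
  to_pure (symmetry f y x) =
  qscale (- (qnorm (to_pure y))^-1) (conjugate (to_pure y) (to_pure x)).
Proof.
rewrite qform_to_pure mulf_eq0 negb_or => /andP[_].
rewrite /symmetry /polar -scaleNr to_pureD to_pureZ !qform_to_pure to_pureD.
have : qre (to_pure x) = 0 by [].
have : qre (to_pure y) = 0 by [].
case: (to_pure y) (to_pure x) => a b c d [a' b' c' d'] /= -> -> N0.
have {}N0 : b ^+ 2 + c ^+ 2 + d ^+ 2 != 0 by rewrite expr0n add0r in N0.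
by congr Quat; field; rewrite N0.
Qed.

Lemma foldr_symmetry_pure (ys : seq 'cV[K]_3) :
  {in ys, forall y, qform f y != 0} ->
  exists q : quat K,
    [/\ qnorm q != 0, \prod_(y <- ys) qform f y = n%:~R ^+ size ys * qnorm q
      & forall x, to_pure (foldr (@symmetry f K) x ys) =
          qscale ((-1) ^+ size ys / qnorm q) (conjugate q (to_pure x))].
Proof.
elim: ys => [_|y ys IH nz].
  exists qone; rewrite big_nil qnorm1 expr0 mul1r.
  split=> [||x] //; first exact: oner_neq0.
  by rewrite conjugate1 divr1 qscale1.
have [|q [q0 prodE symE]] := IH.
  by move=> z zs; apply: nz; rewrite inE zs orbT.
have y0 : qform f y != 0 by apply: nz; rewrite mem_head.
have Ny0 : qnorm (to_pure y) != 0.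
  by move: y0; rewrite qform_to_pure mulf_eq0 negb_or => /andP[].
exists (qmul (to_pure y) q); split=> [||x].
- by rewrite qnormM mulf_neq0.
- by rewrite big_cons prodE qform_to_pure qnormM exprS; ring.
rewrite [foldr _ _ _]/= symmetry_pure // symE conjugateZr qscaleA conjugateM.
by rewrite qnormM exprS; congr qscale; field; rewrite q0.
Qed.

(** The Euler-Rodrigues matrix of conjugation by q on the pure quaternions. *)
Definition rotation_mx (q : quat K) : 'M[K]_3 :=
  let: Quat a b c d := q in
  mx3 (a ^+ 2 + b ^+ 2 - c ^+ 2 - d ^+ 2)
      (2 * (b * c - a * d)) (2 * (b * d + a * c))
      (2 * (b * c + a * d))
      (a ^+ 2 - b ^+ 2 + c ^+ 2 - d ^+ 2) (2 * (c * d - a * b))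
      (2 * (b * d - a * c)) (2 * (c * d + a * b))
      (a ^+ 2 - b ^+ 2 - c ^+ 2 + d ^+ 2).

Definition of_pure_mx : 'M[K]_3 :=
  mx3 u%:~R (- v%:~R) 0 v%:~R u%:~R 0 0 0 4^-1.

Lemma of_pure_mxE a x y z : of_pure_mx *m cV3 x y z = of_pure (Quat a x y z).
Proof. by rewrite mul_mx3_cV3 /=; congr cV3; ring. Qed.

Lemma rotation_mxE q x y z :
  conjugate q (Quat 0 x y z) =
  let w := rotation_mx q *m cV3 x y z in Quat 0 (w 0 0) (w 1 0) (w 2 0).
Proof.
by case: q => a b c d; rewrite /= mul_mx3_cV3 !mxE /=; congr Quat; ring.
Qed.

Lemma det_rotation_mx q : \det (rotation_mx q) = qnorm q ^+ 3.
Proof. by case: q => a b c d; rewrite det_mx3 /=; ring. Qed.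

Lemma det_of_pure_mx : \det of_pure_mx != 0.
Proof.
have -> : \det of_pure_mx = n%:~R / 4 by rewrite det_mx3 nKE; ring.
by rewrite mulf_neq0 ?invr_eq0 ?four_neq0.
Qed.

Lemma of_pureZ e w : of_pure (qscale e w) = e *: of_pure w.
Proof.
case: w => a b c d; rewrite [RHS]cV3E /of_pure /= !mxE /=.
by congr cV3; ring.
Qed.

(** The map sending x to q x conj(q) has determinant qnorm q ^+ 3, so
    a product of an odd number of symmetries has determinant -1: the number of
    symmetries composing A is even.  The product of their f-values is therefore
    qnorm q times a square, and the spinor norm condition allows q to be
    rescaled to norm 1. *)
Lemma in_O'_conjugation (A : 'M[K]_3) : in_O' f A ->
  exists q : quat K, qnorm q = 1 /\
    forall x, to_pure (A *m x) = conjugate q (to_pure x).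
Proof.
move=> [[_ detA] [ys [d [nz AE d0 dE]]]].
have [q [q0 prodE symE]] := foldr_symmetry_pure nz.
have {symE}AE x : to_pure (A *m x) = qscale ((-1) ^+ size ys / qnorm q)
                                          (conjugate q (to_pure x)).
  by rewrite AE symE.
have even_ys : ~~ odd (size ys).
  have E : A *m of_pure_mx =
      ((-1) ^+ size ys / qnorm q) *: (of_pure_mx *m rotation_mx q).
    apply: mulmx_ext => w; rewrite -mulmxA [w]cV3E (of_pure_mxE 0).
    rewrite -[LHS]to_pureK AE of_pureK // of_pureZ rotation_mxE.
    rewrite -scalemxAl -mulmxA [rotation_mx q *m _ in RHS]cV3E.
    by rewrite (of_pure_mxE 0).
  have := congr1 determinant E; rewrite detZ !det_mulmx detA det_rotation_mx.
  rewrite mul1r mulrA mulrAC exprMn exprVn divfK ?expf_neq0 // => detE.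
  apply/negP => odd_ys; move: detE; rewrite -signr_odd odd_ys expr1 => detE.
  have : 2 * \det of_pure_mx = 0 by rewrite mulrDl mul1r {1}detE; ring.
  by move/eqP; rewrite mulf_eq0 (negPf two_neq0) (negPf det_of_pure_mx).
have nq : (d * n%:~R ^+ (size ys)./2) ^+ 2 * qnorm q = 1.
  by rewrite [RHS]dE prodE exprMn -exprM muln2 even_halfK // mulrA.
exists (qscale (d * n%:~R ^+ (size ys)./2) q); split=> [|x].
  by rewrite qnormZ.
rewrite AE -signr_odd (negPf even_ys) mul1r conjugateZl; congr qscale.
by apply: (mulIf q0); rewrite mulVf.
Qed.

End PureQuaternions.

(** * From local to global *)

Definition qi {R : nzRingType} : quat R := Quat 0 1 0 0.

Lemma qmap_qi (R S : nzRingType) (f : {rmorphism R -> S}) : qmap f qi = qi.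
Proof. by rewrite /= rmorph1 rmorph0. Qed.

(** The k-coordinate is 2 (b d - a c), and exactly one of a, b, c, d is odd. *)
Lemma int_conjugate_qi (T : quat int) : (4 %| qnorm T - 1)%Z ->
  (4 %| qim_k (conjugate T qi))%Z.
Proof.
case: T => a b c d /=.
have half (x : int) : exists x' x0 : int, x = 2 * x' + x0 /\ (x0 = 0 \/ x0 = 1).
  by exists (x %/ 2)%Z, (x %% 2)%Z; lia.
have [a' [a0 [-> ha]]] := half a; have [b' [b0 [-> hb]]] := half b.
have [c' [c0 [-> hc]]] := half c; have [d' [d0 [-> hd]]] := half d.
move=> /dvdzP[k kE].
have sq0 (x0 : int) : x0 = 0 \/ x0 = 1 -> x0 ^+ 2 = x0 by case=> ->.
have sum1 : a0 + b0 + c0 + d0 = 1.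
  have E : a0 + b0 + c0 + d0 - 1 = 4 * (k - (a' ^+ 2 + b' ^+ 2 + c' ^+ 2 + d' ^+ 2
      + a' * a0 + b' * b0 + c' * c0 + d' * d0)).
    rewrite -[in LHS](sq0 _ ha) -[in LHS](sq0 _ hb) -[in LHS](sq0 _ hc).
    by rewrite -[in LHS](sq0 _ hd) mulrBr [4 * k]mulrC -kE; ring.
  move: E; move: (k - _) => K; clear kE.
  by case: ha hb hc hd => -> [] -> [] -> [] ->; lia.
clear kE.
have bd0 : b0 * d0 = 0 by move: sum1; case: hb hd => -> [] ->; lia.
have ac0 : a0 * c0 = 0 by move: sum1; case: ha hc => -> [] ->; lia.
apply/dvdzP.
exists (2 * (b' * d' - a' * c') + b' * d0 + b0 * d' - a' * c0 - a0 * c').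
transitivity (2 * ((2 * b' + b0) * (2 * d' + d0) - (2 * a' + a0) * (2 * c' + c0))).
  by ring.
transitivity (4 * (2 * (b' * d' - a' * c') + b' * d0 + b0 * d' - a' * c0 - a0 * c')
   + 2 * (b0 * d0 - a0 * c0)); first by ring.
by rewrite bd0 ac0 subrr mulr0 addr0 mulrC.
Qed.

Lemma padic_conjugate_qi p (pp : prime p) (o : quat (padic_int pp)) :
  qnorm o = 1 -> exists e, qim_k (conjugate o qi) = 4 * e.
Proof.
move=> No; have [p2|p_odd] := eqVneq p 2%N; last first.
  (* 4 is a unit at the odd primes. *)
  have u4 : (4 : padic_int pp) \is a GRing.unit.
    apply: (@coprime_unit _ _ 4); apply: (@coprimeXr 2 p 2).
    by rewrite prime_coprime // dvdn_prime2.
  by exists (4^-1 * qim_k (conjugate o qi)); rewrite mulVKr.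
subst p; have [T [s oE]] := qresidue o 2.
have [r rE] := qnorm_add_scale (2%:R ^+ 2) (qmap intr T) s.
have dvT : (4 %| qnorm T - 1)%Z.
  apply: (@padic_dvd_int 2 pp _ (- r) 2).
  move: rE; rewrite -oE No qnorm_map => rE.
  by rewrite rmorphB rmorph1 [X in _ - X]rE; ring.
have /dvdzP[e eE] := int_conjugate_qi dvT.
have : exists r,
    qim_k (conjugate o qi) = qim_k (conjugate (qmap intr T) qi) + 4 * r.
  rewrite oE; case: (T) (s) => a b c d [a' b' c' d'] /=.
  move: a%:~R b%:~R c%:~R d%:~R => {}a {}b {}c {}d.
  by exists (2 * (b * d' + b' * d - a * c' - a' * c)
             + 8 * (b' * d' - a' * c')); ring.
case=> r' ->; exists (e%:~R + r').
rewrite -[qi](qmap_qi intr) -qmap_conjugate.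
have -> x : qim_k (qmap intr x) = (qim_k x)%:~R :> padic_int pp by case: x.
by rewrite eE rmorphM [RHS]mulrDr; congr (_ + _); exact: mulrC.
Qed.

Section Localization.
Variables (p : nat) (pp : prime p).

Lemma localization_standard (x : 'cV[padic_int pp]_3) :
  localization pp (Zspan 1%:M) (map_mx (@tofrac (padic_int pp)) x).
Proof.
exists 3, (fun i => x i 0), (fun i => delta_mx i 0); split=> [i|].
  by exists (delta_mx i 0); rewrite // mul1mx map_delta_mx.
apply/matrixP => i j; rewrite ord1 summxE (bigD1 i) //= big1 => [|k ki].
  by rewrite addr0 !mxE !eqxx ratr_nat mulr1.
by rewrite !mxE eq_sym (negPf ki) ratr_nat mulr0.
Qed.

Lemma localization_coordinates B w : B \in unitmx -> localization pp (Zspan B) w ->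
  exists y : 'cV[padic_int pp]_3,
    map_mx (rat_padic pp) (invmx B) *m w = map_mx (@tofrac (padic_int pp)) y.
Proof.
move=> Bu [m [c [b [bB ->]]]].
have /choice[z zE] i : exists z : 'cV[int]_3, b i = B *m map_mx intr z.
  by have [z _ <-] := bB i; exists z.
exists (\sum_i c i *: map_mx intr (z i)).
rewrite mulmx_sumr raddf_sum; apply: eq_bigr => i _.
rewrite zE -[ratr]/(rat_padic pp) -scalemxAr -map_mxM mulKmx //.
by apply/matrixP => j k; rewrite !mxE /= tofracM !rmorph_int.
Qed.

End Localization.

Lemma map_of_pure (K L : fieldType) (F : {rmorphism K -> L}) u v w :
  map_mx F (of_pure u v w) = of_pure u v (qmap F w).
Proof.
case: w => a b c d; rewrite [LHS]cV3E /= !mxE /=.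
by rewrite fmorph_div rmorph_nat !(rmorphB, rmorphD, rmorphM, rmorph_int).
Qed.

Lemma qform_map (R S : comNzRingType) (F : {rmorphism R -> S}) f (x : 'cV[R]_3) :
  qform f (map_mx F x) = F (qform f x).
Proof.
by rewrite /qform /eval !mxE !(rmorphD, rmorphM, rmorphXn, rmorph_int).
Qed.

Lemma denq_dvd (x : rat) (a d : int) : x * d%:~R = a%:~R -> (denq x %| d)%Z.
Proof.
move=> xd; rewrite -(@Gauss_dvdzr _ (numq x)); last first.
  by rewrite coprimez_sym coprimezE coprime_num_den.
apply/dvdzP; exists a; apply: (@intr_inj rat).
by rewrite !rmorphM /= -xd numqE; ring.
Qed.

Lemma matrix_denominator m n (C : 'M[rat]_(m, n)) :
  exists (D : nat) (A : 'M[int]_(m, n)), (0 < D)%N /\ D%:R *: C = map_mx intr A.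
Proof.
pose D := (\prod_i \prod_j `|denq (C i j)|)%N.
have /choice[A AE] ij : exists a : int, D%:R * C ij.1 ij.2 = a%:~R.
  case: ij => i j; have [e De] : exists e, D = (e * `|denq (C i j)|)%N.
    by rewrite /D (bigD1 i) //= (bigD1 j) //= -mulnA mulnC; eexists.
  exists (e%:Z * numq (C i j)); rewrite De natrM rmorphM /= numqE.
  by rewrite -mulrA [_%:R * C i j]mulrC [X in _ * (_ * X) = _]pmulrn absz_denq.
exists D, (\matrix_(i, j) A (i, j)); split.
  by apply: prodn_gt0 => i; apply: prodn_gt0 => j; rewrite absz_gt0 denq_neq0.
by apply/matrixP => i j; rewrite !mxE -(AE (i, j)).
Qed.

Lemma rat_int (x : rat) :
  (forall p, prime p -> ~~ (p %| `|denq x|)%N) -> exists z : int, x = z%:~R.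
Proof.
move=> no_p; exists (numq x).
have d1 : `|denq x|%N = 1%N.
  apply/eqP; rewrite eqn_leq absz_gt0 denq_neq0 andbT leqNgt; apply/negP => d_gt1.
  by have := no_p _ (pdiv_prime d_gt1); rewrite pdiv_dvd.
by rewrite -{1}[x]divq_num_den -[denq x]absz_denq d1 divr1.
Qed.

(** The pure t with k-coordinate divisible by 4 are all in the image of Z_p^3, so
    the local isometry at p takes them into the localization of the lattice
    with basis B, that is, to vectors with integral coordinates in B. *)
Lemma local_conjugation (n u v : int) (sigma B : 'M[rat]_3) p (pp : prime p) :
  let f := Ternary 1 1 (16 * n) 0 0 0 in
  n != 0 -> n = u ^+ 2 + v ^+ 2 -> B \in unitmx ->
  (exists2 Sigma : 'M[padic pp]_3, in_O' f Sigma &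
    localization pp (Zspan B) =
    [set map_mx ratr sigma *m (Sigma *m x) | x in localization pp (Zspan 1%:M)]
      %classic) ->
  exists q : quat (padic pp), qnorm q = 1 /\
    forall t : quat (padic_int pp), qre t = 0 -> (exists e, qim_k t = 4 * e) ->
    exists y : 'cV[padic_int pp]_3,
      map_mx (rat_padic pp) (invmx B *m sigma) *m
        of_pure u v (conjugate q (qmap (@tofrac _) t))
      = map_mx (@tofrac (padic_int pp)) y.
Proof.
move=> f n0 nE Bu [Sigma SigmaO' locE].
have nK := intr_padic_neq0 pp n0.
have twoK : 2 != 0 :> padic pp by exact: (tofrac_nat_neq0 pp (n := 2)).
have [q [Nq qE]] := in_O'_conjugation nE nK twoK SigmaO'.
exists q; split=> // -[a b c d] /= -> [e ->].
pose x : 'cV[padic_int pp]_3 :=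
  cV3 (u%:~R * b - v%:~R * c) (v%:~R * b + u%:~R * c) e.
have xE : to_pure n u v (map_mx (@tofrac _) x) =
    Quat (tofrac 0) (tofrac b) (tofrac c) (tofrac (4 * e)).
  rewrite -[RHS](of_pureK nE nK twoK) ?tofrac0 //; congr to_pure.
  rewrite /= [LHS]cV3E !mxE /= tofracM.
  have -> : tofrac (4 : padic_int pp) = 4 by exact: rmorph_nat.
  by rewrite mulrAC divff ?four_neq0 // mul1r
    !(rmorphB, rmorphD, rmorphM, rmorph_int).
have [y yE] : exists y : 'cV[padic_int pp]_3, map_mx (rat_padic pp) (invmx B) *m
    (map_mx ratr sigma *m (Sigma *m map_mx (@tofrac _) x)) = map_mx (@tofrac _) y.
  apply: localization_coordinates => //; rewrite locE.
  by exists (map_mx (@tofrac _) x) => //; apply: localization_standard.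
exists y; rewrite -yE map_mxM -mulmxA; congr (_ *m (_ *m _)).
by rewrite -xE -qE to_pureK.
Qed.

Theorem theorem3p1 (n : nat) (n_gt0 : (0 < n)%N) (n_odd : odd n)
    (n_sqf : squarefree n)
    (n_sum2 : exists u v : int, n%:Z = u ^+ 2 + v ^+ 2)
    (g : ternary) (g_pos : positive_definite g) (g_prim : primitive g)
    (g_spn : in_spinor_genus (Ternary 1 1 (16 * n%:Z) 0 0 0) g) :
  exists x y z : int, eval g x y z = n%:Z.
Proof.
have [u [v nE]] := n_sum2.
have [M [h [_ [sigma [sigma_u sigmaE] locM] [B [Bu ME] hE] [U Uu ghE]]]] := g_spn.
subst M; have n0 : n%:Z != 0 by rewrite eqz_nat -lt0n.
have loc p (pp : prime p) := local_conjugation n0 nE Bu (locM p pp).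
pose x p (pp : prime p) := sval (cid (loc p pp)).
have xP p (pp : prime p) := svalP (cid (loc p pp)).
pose C := invmx B *m sigma *m of_pure_mx rat u v.
have [D [A [D_gt0 DC]]] := matrix_denominator C.
have [p pp _|Q [m [m_gt0 NQ m_primes Qx]]] :=
  @simultaneous_approximation (primes D) x; first exact: (xP p pp).1.
have m2 : (m ^ 2)%N%:R != 0 :> rat by rewrite pnatr_eq0 -lt0n expn_gt0 m_gt0.
(* The rotation of i by Q / m, and the coordinates of its image in M. *)
pose w : quat rat := qscale ((m ^ 2)%N%:R)^-1 (conjugate (qmap intr Q) qi).
have w_pure : qre w = 0 by rewrite qre_scale // qre_conjugate.
pose y := invmx B *m (sigma *m of_pure u v w).
have fy : qform (Ternary 1 1 (16 * n%:Z) 0 0 0) (B *m y) = n%:Z%:~R.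
  have nQ : n%:Z%:~R != 0 :> rat by rewrite intr_eq0.
  rewrite mulKVmx // sigmaE qform_of_pure // /w qnormZ qnorm_conjugate.
  rewrite qnorm_map NQ [qnorm qi](_ : _ = 1); last by rewrite /=; ring.
  by rewrite -pmulrn mulr1 -exprMn mulVf // expr1n mulr1.
have y_den i : exists a : int, y i 0 * (D * m ^ 2)%N%:~R = a%:~R.
  case E : (conjugate Q qi) => [a b c d]; exists ((A *m cV3 b c d) i 0).
  have yE : (D * m ^ 2)%N%:R *: y = map_mx intr (A *m cV3 b c d).
    have -> : y = ((m ^ 2)%N%:R)^-1 *: (C *m map_mx intr (cV3 b c d)).
      rewrite /y /w -[qi](qmap_qi intr) -qmap_conjugate E of_pureZ -!scalemxAr.
      rewrite [map_mx _ _]cV3E !mxE /= -!mulmxA; congr (_ *: (_ *m (_ *m _))).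
      by rewrite (of_pure_mxE _ _ a%:~R).
    by rewrite map_mxM /= -DC -scalemxAl scalerA natrM mulfK.
  by move/matrixP/(_ i 0): yE; rewrite !mxE mulrC.
have y_int i : exists z : int, y i 0 = z%:~R.
  apply: rat_int => p pp; apply/negP => p_den.
  have pD : p \in primes D.
    have : (p %| D * m ^ 2)%N.
      have [a aE] := y_den i; have := denq_dvd aE.
      by rewrite dvdzE; apply: dvdn_trans.
    rewrite Euclid_dvdM // => /orP[pD|]; first by rewrite mem_primes pp D_gt0.
    by rewrite Euclid_dvdX // => /andP[pm _]; apply: m_primes.
  (* Now p is one of the primes where Q / m approximates the local isometry. *)
  have [o oE] := Qx p pp pD.
  have [Nx xloc] := xP p pp.
  have mK : (m%:R : padic pp) != 0 by rewrite tofrac_nat_neq0.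
  have QE : qmap intr Q = qscale m%:R (qmul (x p pp) (qmap (@tofrac _) o)).
    by rewrite -qmulZr -oE qmulA qmul_conj Nx qscale1 qmul1.
  have No : qnorm o = 1.
    apply/eqP; rewrite -tofrac_eq tofrac1 -qnorm_map; apply/eqP.
    apply: (mulfI (expf_neq0 2 mK)).
    rewrite -qnormZ -oE qnormM qnorm_conj Nx qnorm_map NQ.
    by rewrite /= -pmulrn natrX mul1r mulr1.
  have wE : qmap (rat_padic pp) w =
      conjugate (x p pp) (qmap (@tofrac _) (conjugate o qi)).
    rewrite qmap_scale qmap_conjugate qmap_intr QE qmap_qi conjugateZl qscaleA.
    rewrite fmorphV rmorph_nat natrX mulVf ?expf_neq0 // qscale1 conjugateM.
    by rewrite qmap_conjugate qmap_qi.
  have [|z zE] := xloc (conjugate o qi) _ (padic_conjugate_qi No).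
    exact: qre_conjugate.
  have : map_mx (rat_padic pp) y = map_mx (@tofrac _) z.
    by rewrite -zE -wE -map_of_pure -map_mxM /y mulmxA.
  move=> /matrixP/(_ i 0); rewrite [LHS]mxE [RHS]mxE.
  move=> /padic_integer_rat_denominator.
  by rewrite p_den.
have /choice[z zE] := y_int.
pose zv : 'cV[int]_3 := \col_i z i.
have yE : y = map_mx intr zv.
  by apply/matrixP => i j; rewrite ord1 zE !mxE.
pose t := invmx U *m zv.
exists (t 0 0), (t 1 0), (t 2 0).
rewrite -[LHS]/(qform g t) ghE mulKVmx //; apply: (@intr_inj rat).
by rewrite -qform_map -yE hE fy.
Qed.
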